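(* Let $\mathcal F$ be a set of $2$-edge-coloured graphs on three vertices. If $\mathcal F\subseteq\{3K_1,{}^r\overline{P_3},{}^b\overline{P_3},{}^rP_3,{}^{rb}P_3,{}^rK_3,{}^{rrb}K_3\}$ or $\mathcal F\subseteq\{3K_1,{}^r\overline{P_3},{}^b\overline{P_3},{}^bP_3,{}^{rb}P_3,{}^bK_3,{}^{rbb}K_3\}$, then the $\mathcal F$-free colouring problem can be solved in polynomial time.
   Context: Graphs are finite and simple. A $2$-edge-colouring of $G$ assigns to every edge the colour red or blue (not necessarily properly). For a set $\mathcal F$ of $2$-edge-coloured graphs, a $2$-edge-colouring of $G$ is $\mathcal F$-free if no induced $2$-edge-coloured subgraph is isomorphic (preserving colours) to a member of $\mathcal F$. The $\mathcal F$-free colouring problem is to decide whether an input graph $G$ admits an $\mathcal F$-free $2$-edge-colouring. Patterns on three vertices: $3K_1$ is the edgeless graph; ${}^r\overline{P_3}$ (resp. ${}^b\overline{P_3}$) has exactly one edge, coloured red (resp. blue); ${}^rP_3$, ${}^bP_3$, ${}^{rb}P_3$ are the path on three vertices with both edges red, both edges blue, or one edge of each colour; ${}^rK_3$, ${}^bK_3$, ${}^{rrb}K_3$, ${}^{rbb}K_3$ are the triangle with all edges red, all edges blue, two red and one blue, or one red and two blue edges, respectively. *)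

(* Defs.v *)
From HB Require Import structures.
From Stdlib Require List.
From mathcomp Require Import all_boot all_order all_algebra.
Set Implicit Arguments.
Unset Strict Implicit.
Unset Printing Implicit Defensive.

Variant move := MoveLeft | Stay | MoveRight.

(* The tape alphabet is [option (bool + tm_work)]: [None] is the blank,
   [Some (inl b)] an input bit and [Some (inr a)] a work symbol.
   A state is halting when its verdict is [Some _]; there are [tm_k.+1] tapes,
   infinite in both directions, and the input is written on tape [ord0]. *)
Record tm := TM {
  tm_k : nat;
  tm_work : finType;
  tm_state : finType;
  tm_start : tm_state;
  tm_verdict : tm_state -> option bool;
  tm_delta : tm_state ->
    {ffun 'I_tm_k.+1 -> option (bool + tm_work)} ->
    tm_state * {ffun 'I_tm_k.+1 -> option (bool + tm_work) * move} }.

Definition tm_sym (M : tm) : Type := option (bool + tm_work M).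

Record config (M : tm) := Config {
  cf_state : tm_state M;
  cf_tape : 'I_(tm_k M).+1 -> int -> tm_sym M;
  cf_head : 'I_(tm_k M).+1 -> int }.

Definition shift (m : move) (z : int) : int :=
  match m with
  | MoveLeft => (z - 1)%R
  | Stay => z
  | MoveRight => (z + 1)%R
  end.

Definition input_tape (M : tm) (w : seq bool) (z : int) : tm_sym M :=
  match z with
  | Posz i => omap inl (onth w i)
  | Negz _ => None
  end.

Definition init (M : tm) (w : seq bool) : config M :=
  {| cf_state := tm_start M;
     cf_tape := fun i => if i == ord0 then input_tape M w else fun=> None;
     cf_head := fun=> 0%R |}.

(* Halting configurations are fixed points of [step], so that the verdict
   reached by a run is unique. *)
Definition step (M : tm) (c : config M) : config M :=
  if tm_verdict (cf_state c) is Some _ then c else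
  let: (q, a) := tm_delta (cf_state c)
                   [ffun i => cf_tape c i (cf_head c i)] in
  {| cf_state := q;
     cf_tape := fun i z =>
       if z == cf_head c i then (a i).1 else cf_tape c i z;
     cf_head := fun i => shift (a i).2 (cf_head c i) |}.

Definition run (M : tm) (w : seq bool) (t : nat) : config M :=
  iter t (@step M) (init M w).

(* The decision problem with instances [I], encoded as words by [enc], and
   yes-instances [P] is solvable in time polynomial in the encoding length. *)
Definition polytime_solvable (I : Type) (enc : I -> seq bool)
    (P : I -> Prop) : Prop :=
  exists (M : tm) (p : {poly nat}), forall x : I,
    exists (t : nat) (b : bool),
      [/\ t <= (p.[size (enc x)])%R,
          tm_verdict (cf_state (run M (enc x) t)) = Some b
        & b <-> P x].

Record sgraph := SGraph {
  vertex :> finType;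
  adj : rel vertex;
  adj_sym : symmetric adj;
  adj_irr : irreflexive adj }.

Variant colour := Red | Blue.

(* A function on the edges of [G] is given as a symmetric function on pairs
   of vertices; its values on non-adjacent pairs are never used. *)
Record colouring (G : sgraph) := Colouring {
  col :> G -> G -> colour;
  col_sym : forall x y, col x y = col y x }.

Record cgraph := CGraph {
  under :> sgraph;
  edge_col : colouring under }.

Definition ciso (C D : cgraph) : Prop :=
  exists f : C -> D,
    [/\ bijective f,
        forall x y, adj (f x) (f y) = adj x y
      & forall x y, adj x y ->
          edge_col D (f x) (f y) = edge_col C x y].

Section Induced.
Variables (C : cgraph) (S : {set C}).

Definition induced_adj : rel {x : C | x \in S} :=
  fun x y => adj (val x) (val y).

Lemma induced_adj_sym : symmetric induced_adj.
Proof. by move=> x y; apply: adj_sym. Qed.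

Lemma induced_adj_irr : irreflexive induced_adj.
Proof. by move=> x; apply: adj_irr. Qed.

Definition induced_sgraph : sgraph := SGraph induced_adj_sym induced_adj_irr.

Definition induced_colouring : colouring induced_sgraph :=
  @Colouring induced_sgraph (fun x y => edge_col C (val x) (val y))
    (fun x y => col_sym (edge_col C) (val x) (val y)).

Definition induced : cgraph := CGraph induced_colouring.
End Induced.

Definition free (F : cgraph -> Prop) (C : cgraph) : Prop :=
  forall (S : {set C}) (H : cgraph), F H -> ~ ciso (induced S) H.

Definition free_colouring_problem (F : cgraph -> Prop) (G : sgraph) : Prop :=
  exists c : colouring G, free F (CGraph c).

(* The number of vertices in unary, a delimiter, and the adjacency matrix in
   row-major order. *)
Definition encode (G : sgraph) : seq bool :=
  nseq #|G| true ++ false :: [seq adj x y | x <- enum G, y <- enum G].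

Section Pattern.
Variables a01 a12 a02 : option colour.

(* For distinct [i], [j] the sum [i + j] determines the pair {i, j}. *)
Definition pat_label (i j : 'I_3) : option colour :=
  match i + j with
  | 1 => a01
  | 2 => a02
  | _ => a12
  end.

Definition pat_adj : rel 'I_3 := fun i j => (i != j) && isSome (pat_label i j).

Lemma pat_adj_sym : symmetric pat_adj.
Proof. by move=> i j; rewrite /pat_adj /pat_label eq_sym addnC. Qed.

Lemma pat_adj_irr : irreflexive pat_adj.
Proof. by move=> i; rewrite /pat_adj eqxx. Qed.

Definition pat_sgraph : sgraph := SGraph pat_adj_sym pat_adj_irr.

Definition pat_col (i j : 'I_3) : colour := odflt Blue (pat_label i j).

Lemma pat_col_sym (i j : 'I_3) : pat_col i j = pat_col j i.
Proof. by rewrite /pat_col /pat_label addnC. Qed.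

Definition pat : cgraph := CGraph (@Colouring pat_sgraph pat_col pat_col_sym).
End Pattern.

Definition e3K1 : cgraph := pat None None None.
Definition r_coP3 : cgraph := pat (Some Red) None None.
Definition b_coP3 : cgraph := pat (Some Blue) None None.
Definition r_P3 : cgraph := pat (Some Red) (Some Red) None.
Definition b_P3 : cgraph := pat (Some Blue) (Some Blue) None.
Definition rb_P3 : cgraph := pat (Some Red) (Some Blue) None.
Definition r_K3 : cgraph := pat (Some Red) (Some Red) (Some Red).
Definition b_K3 : cgraph := pat (Some Blue) (Some Blue) (Some Blue).
Definition rrb_K3 : cgraph := pat (Some Red) (Some Red) (Some Blue).
Definition rbb_K3 : cgraph := pat (Some Red) (Some Blue) (Some Blue).

(* Coloured graphs are considered up to isomorphism. *)
Definition among (F : cgraph -> Prop) (ps : seq cgraph) : Prop :=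
  forall H, F H -> exists2 P, List.In P ps & ciso H P.

(* Main.v *)
(** With the first list, the admissible sets of red edges are the models of a
    Horn theory: for triples in the order (xy, yz, xz), every pattern of the
    first list has one orientation in which xy and yz are non-edges or red. If
    xz is blue there, the pattern says that red (or absent) xy and yz force xz to
    be red; otherwise it is a purely negative clause. Propagating forced edges
    for n^2 + 1 rounds over all triples either violates a negative clause, and
    then no colouring exists, or reaches in some round a fixed point, whose
    forced edges are the red class of a solution. The second list is the first
    one with the colours exchanged.

    The Turing machine keeps the partially coloured adjacency matrix on its
    input tape and each loop variable as the position of a head on a tape that
    carries the number of vertices in unary. *)
Require Import Defs.
From Stdlib Require Import FunctionalExtensionality Classical.
From mathcomp Require Import all_boot all_order all_algebra zify.
Set Implicit Arguments.
Unset Strict Implicit.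
Unset Printing Implicit Defensive.
Import GRing.Theory.

(** * Structured programs for multi-tape Turing machines *)

Section Programs.
Variables (k : nat) (W : finType).

Let sym := option (bool + W).
Let reads := {ffun 'I_k.+1 -> sym}.
Let acts := {ffun 'I_k.+1 -> sym * move}.

Local Notation tapes := ('I_k.+1 -> int -> sym).
Local Notation heads := ('I_k.+1 -> int).
Local Notation mem := (tapes * heads)%type.

Inductive prog :=
| Act of reads -> acts
| Seq of prog & prog
| If of pred reads & prog & prog
| While of pred reads & prog.

(** [None] in a conditional or a loop is the state that evaluates the test, at the cost of one idle
    step. *)
Fixpoint pstate (p : prog) : finType :=
  match p with
  | Act _ => unit
  | Seq p q => (pstate p + pstate q)%type
  | If _ p q => option (pstate p + pstate q)
  | While _ p => option (pstate p)
  end.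

Fixpoint pstart (p : prog) : pstate p :=
  match p with
  | Act _ => tt
  | Seq p _ => inl (pstart p)
  | If _ _ _ => None
  | While _ _ => None
  end.

Definition idle (r : reads) : acts := [ffun i => (r i, Stay)].

(* The successor state [None] means that the program exits. *)
Fixpoint pdelta (p : prog) : pstate p -> reads -> option (pstate p) * acts :=
  match p return pstate p -> reads -> option (pstate p) * acts with
  | Act g => fun _ r => (None, g r)
  | Seq p q => fun s r =>
      match s with
      | inl s => let: (o, a) := pdelta s r in
          (if o is Some s' then Some (inl s') else Some (inr (pstart q)), a)
      | inr s => let: (o, a) := pdelta s r in
          (if o is Some s' then Some (inr s') else None, a)
      end
  | If b p q => fun s r =>
      match s with
      | None => (Some (Some (if b r then inl (pstart p) else inr (pstart q))),
                 idle r)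
      | Some (inl s) => let: (o, a) := pdelta s r in
          (if o is Some s' then Some (Some (inl s')) else None, a)
      | Some (inr s) => let: (o, a) := pdelta s r in
          (if o is Some s' then Some (Some (inr s')) else None, a)
      end
  | While b p => fun s r =>
      match s with
      | None => (if b r then Some (Some (pstart p)) else None, idle r)
      | Some s => let: (o, a) := pdelta s r in
          (if o is Some s' then Some (Some s') else Some None, a)
      end
  end.

Definition scan (m : mem) : reads := [ffun i => m.1 i (m.2 i)].

Definition perform (a : acts) (m : mem) : mem :=
  (fun i z => if z == m.2 i then (a i).1 else m.1 i z,
   fun i => shift (a i).2 (m.2 i)).

Definition mstep (S : Type) (d : S -> reads -> option S * acts)
    (c : option S * mem) : option S * mem :=
  if c.1 is Some s then
    let: (o, a) := d s (scan c.2) in (o, perform a c.2)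
  else c.

Lemma iter_mstep_exited (S : Type) (d : S -> reads -> option S * acts) t m :
  iter t (mstep d) (None, m) = (None, m).
Proof. by elim: t => //= t ->. Qed.

(* Exited configurations are fixed points of [mstep], so this says that [p]
   turns [m] into [m'] within at most [t] steps. *)
Definition runs (p : prog) (m m' : mem) (t : nat) : Prop :=
  iter t (mstep (@pdelta p)) (Some (pstart p), m) = (None, m').

Lemma runs_leq p m m' t t' : runs p m m' t -> t <= t' -> runs p m m' t'.
Proof.
by move=> pP /subnK <-; rewrite /runs iterD pP iter_mstep_exited.
Qed.

(** Simulation of a component inside a composite: [f] embeds its states and its exit is redirected
    to [e]. The number of steps must be exact, since the composite may run on from [e]; hence some
    [t'] below [t]. *)
Lemma mstep_embed (A B : Type) (dA : A -> reads -> option A * acts)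
    (dB : B -> reads -> option B * acts) (f : A -> B) (e : option B) :
    (forall s r, dB (f s) r =
       (if (dA s r).1 is Some s' then Some (f s') else e, (dA s r).2)) ->
  forall t s m m', iter t (mstep dA) (Some s, m) = (None, m') ->
  exists2 t', t' <= t & iter t' (mstep dB) (Some (f s), m) = (e, m').
Proof.
move=> dBE; elim=> [|t IHt] s m m' //; rewrite iterSr.
rewrite [mstep dA _]/mstep /=; case dE: (dA s (scan m)) => [[s'|] a] /=.
  case/IHt=> t' le_t' t'P; exists t'.+1 => //.
  by rewrite iterSr [mstep dB _]/mstep /= dBE dE.
rewrite iter_mstep_exited => -[<-]; exists 1 => //=.
by rewrite [mstep dB _]/mstep /= dBE dE.
Qed.

Lemma perform_idle m : perform (idle (scan m)) m = m.
Proof.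
case: m => T h; congr (_, _); apply: functional_extensionality => i /=.
  by apply: functional_extensionality => z; rewrite !ffunE /=; case: eqP => [->|].
by rewrite !ffunE.
Qed.

Lemma runs_act g m : runs (Act g) m (perform (g (scan m)) m) 1.
Proof. by []. Qed.

Lemma runs_seq p q m1 m2 m3 t1 t2 :
  runs p m1 m2 t1 -> runs q m2 m3 t2 -> runs (Seq p q) m1 m3 (t1 + t2).
Proof.
move=> pP qP.
have [|t1' le1 P1] := mstep_embed (dB := @pdelta (Seq p q)) (f := inl)
  (e := Some (inr (pstart q))) _ pP.
  by move=> s r /=; case: pdelta.
have [|t2' le2 P2] := mstep_embed (dB := @pdelta (Seq p q)) (f := inr)
  (e := None) _ qP.
  by move=> s r /=; case: pdelta.
apply: (@runs_leq _ _ _ (t2' + t1')); last by rewrite addnC leq_add.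
by rewrite /runs iterD P1.
Qed.

Lemma runs_if (b : pred reads) p q m m' t :
  (if b (scan m) then runs p m m' t else runs q m m' t) ->
  runs (If b p q) m m' t.+1.
Proof.
rewrite /runs => H; rewrite iterSr [mstep _ _]/mstep /= perform_idle.
case: ifP H => _ H.
  have [|t' le_t P] := mstep_embed (dB := @pdelta (If b p q))
    (f := Some \o inl) (e := None) _ H.
    by move=> s r /=; case: pdelta.
  by move: le_t => /subnK <-; rewrite iterD P iter_mstep_exited.
have [|t' le_t P] := mstep_embed (dB := @pdelta (If b p q))
  (f := Some \o inr) (e := None) _ H.
  by move=> s r /=; case: pdelta.
by move: le_t => /subnK <-; rewrite iterD P iter_mstep_exited.
Qed.

Lemma runs_while_exit (b : pred reads) p m :
  ~~ b (scan m) -> runs (While b p) m m 1.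
Proof.
by move/negPf=> bF; rewrite /runs /= /mstep /= bF perform_idle.
Qed.

Lemma runs_while_step (b : pred reads) p m1 m2 m3 t1 t2 :
  b (scan m1) -> runs p m1 m2 t1 -> runs (While b p) m2 m3 t2 ->
  runs (While b p) m1 m3 (t2 + t1).+1.
Proof.
move=> bT pP wP; rewrite /runs iterSr [mstep _ _]/mstep /= bT perform_idle.
have [|t1' le1 P1] := mstep_embed (dB := @pdelta (While b p)) (f := Some)
  (e := Some None) _ pP.
  by move=> s r /=; case: pdelta.
have: t2 + t1' <= t2 + t1 by rewrite leq_add2l.
by move/subnK <-; rewrite iterD iterD P1 [iter t2 _ _]wP iter_mstep_exited.
Qed.

(** [P v] describes the memory after [v] runs of the body. Each of the [N] runs is preceded by one
    test, and a last test leaves the loop. *)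
Lemma runs_while (b : pred reads) p (P : nat -> mem -> Prop) N t m :
    (forall v m, v < N -> P v m ->
       b (scan m) /\ exists2 m', runs p m m' t & P v.+1 m') ->
    (forall m, P N m -> ~~ b (scan m)) -> P 0 m ->
  exists2 m', runs (While b p) m m' (N * t.+1).+1 & P N m'.
Proof.
elim: N P m => [|N IHN] P m PS PN P0.
  by exists m => //; apply: runs_while_exit; apply: PN.
have [b0 [m1 p0 P1]] := PS 0 m isT P0.
have [m' wP Pm'] := IHN (fun v => P v.+1) m1 (fun v m lt_vN => PS v.+1 m lt_vN) PN P1.
by exists m' => //; apply: runs_leq (runs_while_step b0 p0 wP) _; lia.
Qed.

(** * Elementary moves and writes; programs as machines *)

Definition upd (A : Type) (h : 'I_k.+1 -> A) x v : 'I_k.+1 -> A :=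
  fun i => if i == x then v else h i.

Definition write (T : tapes) x (z : int) (s : sym) : tapes :=
  upd T x (fun z' => if z' == z then s else T x z').

Definition Move x d : prog :=
  Act (fun r => [ffun i => (r i, if i == x then d else Stay)]).

Definition Write x (g : reads -> sym) : prog :=
  Act (fun r => [ffun i => (if i == x then g r else r i, Stay)]).

Lemma runs_move x d T h : runs (Move x d) (T, h) (T, upd h x (shift d (h x))) 1.
Proof.
have -> : (T, upd h x (shift d (h x))) =
  perform [ffun i => (scan (T, h) i, if i == x then d else Stay)] (T, h).
  rewrite /perform; congr (_, _); apply: functional_extensionality => i /=.
    by apply: functional_extensionality => z; rewrite !ffunE /=; case: eqP => [->|].
  by rewrite !ffunE /upd; case: eqP => [->|].
exact: runs_act.
Qed.

Lemma runs_write x g T h :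
  runs (Write x g) (T, h) (write T x (h x) (g (scan (T, h))), h) 1.
Proof.
have -> : (write T x (h x) (g (scan (T, h))), h) =
  perform [ffun i => (if i == x then g (scan (T, h)) else scan (T, h) i, Stay)]
    (T, h).
  rewrite /perform; congr (_, _); apply: functional_extensionality => i /=.
    apply: functional_extensionality => z; rewrite /write /upd !ffunE /=.
    by case: eqP => [->|_] //=; case: eqP => [->|].
  by rewrite !ffunE.
exact: runs_act.
Qed.

(* The extra step turns the symbol under head [x] into the verdict. *)
Definition machine (p : prog) (x : 'I_k.+1) (acc : pred sym) : tm :=
  @TM k W (option (pstate p) + bool)%type (inl (Some (pstart p)))
    (fun s => if s is inr b then Some b else None)
    (fun s r => match s with
       | inl (Some s) => let: (o, a) := pdelta s r in (inl o, a)
       | inl None => (inr (acc (r x)), idle r)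
       | inr b => (inr b, idle r)
       end).

Definition word_tape (w : seq bool) (z : int) : sym :=
  if z is Posz i then omap inl (onth w i) else None.

Lemma machine_run p x acc w m' t :
    runs p (fun i => if i == ord0 then word_tape w else fun=> None, fun=> 0%R)
      m' t ->
  tm_verdict (cf_state (run (machine p x acc) w t.+1)) =
    Some (acc (m'.1 x (m'.2 x))).
Proof.
set M := machine p x acc => pP.
pose cfg (c : option (pstate p) * mem) : config M :=
  @Config M (inl c.1) c.2.1 c.2.2.
have cfg_run u s m : iter u (mstep (@pdelta p)) (Some s, m) = (None, m') ->
    exists2 u', u' <= u & iter u' (@step M) (cfg (Some s, m)) = cfg (None, m').
  elim: u s m => [//|u IHu] s [T h]; rewrite iterSr [mstep _ _]/mstep /=.
  have stepE : step (cfg (Some s, (T, h))) =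
      let: (o, a) := pdelta s (scan (T, h)) in cfg (o, perform a (T, h)).
    by rewrite /step /= /scan /=; case: pdelta.
  case: pdelta stepE => [[s'|] a] stepE.
    case/IHu=> u' le_u' u'P; exists u'.+1; first exact: le_u'.
    by rewrite iterSr stepE.
  by rewrite iter_mstep_exited => -[<-]; exists 1.
have [u' le_u' u'P] := cfg_run _ _ _ pP.
(* The program may exit before step [t]; the verdict comes one step later and then persists. *)
have halt d : tm_verdict (cf_state (iter d.+1 (@step M) (cfg (None, m')))) =
    Some (acc (m'.1 x (m'.2 x))).
  rewrite iterSr; set c := step _.
  have cE : tm_verdict (cf_state c) = Some (acc (m'.1 x (m'.2 x))).
    by rewrite /= ffunE.
  have stepc : step c = c by rewrite {1}/step cE.
  by elim: d => //= d; rewrite -iterS iterSr stepc.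
by rewrite /run -(subnK le_u') -addSn iterD u'P halt.
Qed.

Lemma updE (A : Type) (h : 'I_k.+1 -> A) x v y :
  upd h x v y = if y == x then v else h y.
Proof. by []. Qed.

Lemma upd_upd (A : Type) (h : 'I_k.+1 -> A) x v w : upd (upd h x v) x w = upd h x w.
Proof. by apply: functional_extensionality => i; rewrite !updE; case: eqP. Qed.

Lemma upd_id (A : Type) (h : 'I_k.+1 -> A) x v : h x = v -> upd h x v = h.
Proof.
by move=> <-; apply: functional_extensionality => i; rewrite updE; case: eqP => [->|].
Qed.

Lemma runs_cast p m m1 m2 t1 t2 :
  runs p m m1 t1 -> m1 = m2 -> t1 <= t2 -> runs p m m2 t2.
Proof. by move=> pP <-; apply: runs_leq. Qed.

(** * Loops counted by head positions *)

Definition nonblank x : pred reads := fun r => r x.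

(** Cell 0 is found as the right neighbour of the blank at cell -1, provided that no blank lies
    between it and the head. *)
Definition Rewind x : prog :=
  Seq (While (nonblank x) (Move x MoveLeft)) (Move x MoveRight).

Lemma runs_rewind x N (T : tapes) (h : heads) :
    (forall v : nat, v < N -> T x v) -> T x (-1)%R = None ->
    h x = (N%:Z - 1)%R ->
  runs (Rewind x) (T, h) (T, upd h x 0%R) (N * 2 + 2).
Proof.
move=> TN T1 hx.
pose P (v : nat) m := m = (T, upd h x (N%:Z - 1 - v%:Z)%R).
have [|||m wP mE] := @runs_while (nonblank x) (Move x MoveLeft) P N 1 (T, h).
- move=> v m lt_vN ->; split.
    rewrite /nonblank ffunE /= updE eqxx.
    have -> : (N%:Z - 1 - v%:Z)%R = (N - v.+1)%N by lia.
    by apply: TN; lia.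
  eexists; first exact: runs_move.
  by rewrite /P upd_upd updE eqxx /=; congr (_, upd _ _ _); lia.
- move=> m ->; rewrite /nonblank ffunE /= updE eqxx.
  by rewrite (_ : (_ - _)%R = (-1)%R) ?T1 //; lia.
- by rewrite /P upd_id //; lia.
rewrite mE in wP; apply: runs_cast (runs_seq wP (runs_move _ _ _ _)) _ _.
  by rewrite upd_upd updE eqxx /=; congr (_, upd _ _ _); lia.
lia.
Qed.

Definition unary (n : nat) (z : int) : sym :=
  if z is Posz v then if v < n then Some (inl true) else None else None.

(** The first blank of the unary tape ends the loop. The step to the left leaves this blank, on
    which the loop in [Rewind] would stop at once. *)
Definition For x p : prog :=
  Seq (While (nonblank x) (Seq p (Move x MoveRight)))
    (Seq (Move x MoveLeft) (Rewind x)).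

(** The position of head [x] is fixed by [upd], apart from the invariant; the body may use the loop
    variable but must bring its head back. *)
Lemma runs_for x p n t (P : nat -> tapes -> heads -> Prop) T h :
    (forall v T h, P v T h -> T x = unary n) ->
    (forall v T h, v < n -> P v T h ->
       exists T' h', runs p (T, upd h x (Posz v)) (T', upd h' x (Posz v)) t /\
                     P v.+1 T' h') ->
    P 0 T h ->
  exists T' h', runs (For x p) (T, upd h x 0%R) (T', upd h' x 0%R)
                  (n * (t + 4) + 4) /\ P n T' h'.
Proof.
move=> Px PS P0.
pose Q v m := exists T h, P v T h /\ m = (T, upd h x (Posz v)).
have [|||m wP [T' [h' [Pn mE]]]] := @runs_while (nonblank x)
  (Seq p (Move x MoveRight)) Q n (t + 1) (T, upd h x 0%R).
- move=> v m lt_vn [T1 [h1 [P1 ->]]]; split.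
    by rewrite /nonblank ffunE /= updE eqxx (Px _ _ _ P1) /= lt_vn.
  have [T2 [h2 [pP P2]]] := PS _ _ _ lt_vn P1.
  eexists; first exact: runs_seq pP (runs_move _ _ _ _).
  exists T2, h2; split=> //.
  by rewrite upd_upd updE eqxx /=; congr (_, upd _ _ _); lia.
- move=> m [T1 [h1 [P1 ->]]].
  by rewrite /nonblank ffunE /= updE eqxx (Px _ _ _ P1) /= ltnn.
- by exists T, h.
exists T', h'; split=> //.
have Tx := Px _ _ _ Pn; rewrite mE in wP.
apply: runs_cast (runs_seq wP (runs_seq (runs_move _ _ _ _)
  (@runs_rewind x n _ _ _ _ _))) _ _.
- by move=> v lt_vn; rewrite Tx /= lt_vn.
- by rewrite Tx.
- by rewrite !updE eqxx /=; lia.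
- by rewrite !upd_upd.
lia.
Qed.

(** Head [x] itself counts down from its position X to -1, so the body runs X + 1 times; the second
    loop restores the head. *)
Definition Repeat x s p : prog :=
  Seq (While (nonblank x) (Seq p (Seq (Move x MoveLeft) (Move s MoveRight))))
    (Seq (Move s MoveLeft)
      (Seq (While (nonblank s) (Seq (Move s MoveLeft) (Move x MoveRight)))
        (Move s MoveRight))).

(* The scratch head [s] records how far head [x] has moved left. *)
Lemma runs_repeat (x s : 'I_k.+1) p n t X (M : nat -> heads) (T : tapes) :
    x != s -> T x = unary n -> T s = unary n -> X < n ->
    (forall v, v <= X -> runs p (T, upd (upd (M v) x (X - v)%N) s v)
                         (T, upd (upd (M v.+1) x (X - v)%N) s v) t) ->
  runs (Repeat x s p) (T, upd (upd (M 0) x X) s 0%R)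
    (T, upd (upd (M X.+1) x X) s 0%R) (n * (t + 6) + 4).
Proof.
move=> neq_xs Tx Ts ltXn pP; have neq_sx : s != x by rewrite eq_sym.
pose P (v : nat) m := m = (T, upd (upd (M v) x (X%:Z - v%:Z)%R) s (Posz v)).
have [|||m wP mE] := @runs_while (nonblank x)
  (Seq p (Seq (Move x MoveLeft) (Move s MoveRight))) P X.+1 (t + (1 + 1))
  (T, upd (upd (M 0) x X) s 0%R).
- move=> v m le_vX ->; have XvE : (X%:Z - v%:Z)%R = (X - v)%N by lia.
  split.
    rewrite /nonblank ffunE /= !updE eqxx (negPf neq_xs) Tx XvE /=.
    by rewrite (leq_ltn_trans (leq_subr _ _)).
  rewrite XvE; eexists.
    exact: runs_seq (pP v le_vX) (runs_seq (runs_move _ _ _ _) (runs_move _ _ _ _)).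
  congr (_, _); apply: functional_extensionality => i; rewrite !updE.
  rewrite !eqxx (negPf neq_xs) (negPf neq_sx) /=.
  case: (i =P s) => _; last case: (i =P x) => // _.
    by lia.
  by lia.
- move=> m ->; rewrite /nonblank ffunE /= !updE eqxx (negPf neq_xs) Tx.
  by rewrite (_ : (_ - _)%R = (-1)%R) //; lia.
- by rewrite /P subr0.
pose Q (v : nat) m := m = (T, upd (upd (M X.+1) x (v%:Z - 1)%R) s (X%:Z - v%:Z)%R).
have [|||m' wQ mE'] := @runs_while (nonblank s)
  (Seq (Move s MoveLeft) (Move x MoveRight)) Q X.+1 (1 + 1)
  (T, upd (upd (M X.+1) x (-1)%R) s X).
- move=> v m1 le_vX ->; have XvE : (X%:Z - v%:Z)%R = (X - v)%N by lia.
  split.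
    rewrite /nonblank ffunE /= !updE eqxx Ts XvE /=.
    by rewrite (leq_ltn_trans (leq_subr _ _)).
  eexists; first exact: runs_seq (runs_move _ _ _ _) (runs_move _ _ _ _).
  congr (_, _); apply: functional_extensionality => i; rewrite !updE !eqxx (negPf neq_xs).
  case: (i =P s) => [->|_]; first by rewrite (negPf neq_sx) /=; lia.
  by case: (i =P x) => //= _; lia.
- move=> m1 ->; rewrite /nonblank ffunE /= !updE eqxx Ts.
  by rewrite (_ : (_ - _)%R = (-1)%R) //; lia.
- by rewrite /Q subr0.
rewrite mE' in wQ.
(* Head [s] stands at X + 1, possibly already on a blank; one step to the left makes the second loop
   run exactly X + 1 times. *)
have mid : runs (Move s MoveLeft) m (T, upd (upd (M X.+1) x (-1)%R) s X) 1.
  rewrite mE; apply: runs_cast (runs_move _ _ _ _) _ (leqnn _).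
  rewrite upd_upd updE eqxx /=.
  by congr (_, upd (upd _ _ _) _ _); lia.
apply: runs_cast (runs_seq wP (runs_seq mid (runs_seq wQ (runs_move _ _ _ _)))) _ _.
  rewrite upd_upd updE eqxx /=.
  by congr (_, upd (upd _ _ _) _ _); lia.
nia.
Qed.

End Programs.

(** * Access to the adjacency matrix *)

(* Tape 0 is the input tape, tapes 1 to 7 are the registers (1 counts the steps
   of a move by a whole row, 2 is the scratch tape of [Repeat], the others are
   loop variables), tapes 8 to 11 are flags, whose only used cell is 0. *)
Notation tape i := (@Ordinal 12 i isT).
Notation symbol := (option (bool + bool)).
Notation program := (prog 11 bool).
Notation tapes := ('I_12 -> int -> symbol).
Notation heads := ('I_12 -> int).

(* The possible entries of the matrix; [forced] marks the edges that are already
   known to be red. *)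
Notation nonedge := (Some (inl false) : symbol).
Notation edge := (Some (inl true) : symbol).
Notation forced := (Some (inr true) : symbol).
Notation diagonal := (Some (inr false) : symbol).

Definition is_register (i : 'I_12) := 0 < i < 8.
Definition is_flag (i : 'I_12) := 7 < i.

(* [Repeat x] runs its body one time too many, which skips exactly the unary
   number of vertices and the delimiter preceding the matrix. *)
Definition Goto x y : program :=
  Seq (Repeat x (tape 2) (For (tape 1) (Move _ ord0 MoveRight)))
      (Repeat y (tape 2) (Move _ ord0 MoveRight)).

Section Navigation.
Variables (n : nat) (T : tapes).
Hypothesis Treg : forall i, is_register i -> T i = unary bool n.

Lemma runs_repeat_displace (x : 'I_12) (p : program) t d X (h : heads) :
    2 < x < 8 -> h x = Posz X -> X < n -> h (tape 1) = 0%R -> h (tape 2) = 0%R ->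
    (forall h : heads, h (tape 1) = 0%R ->
       runs p (T, h) (T, upd h ord0 (h ord0 + Posz d)%R) t) ->
  runs (Repeat x (tape 2) p) (T, h)
    (T, upd h ord0 (h ord0 + Posz (X.+1 * d))%R) (n * (t + 6) + 4).
Proof.
move=> xr hx ltXn h1 h2 pP.
have [x0 x1 x2] : [/\ x != ord0, x != tape 1 & x != tape 2].
  by split; apply: contraTneq xr => ->.
have [x0' x1'] : (ord0 == x = false) /\ (tape 1 == x = false).
  by split; rewrite eq_sym; apply: negbTE.
pose M (v : nat) : heads := upd h ord0 (h ord0 + Posz (v * d))%R.
have E v : upd (upd (M v) x X) (tape 2) 0%R = M v.
  have Mx : M v x = Posz X by rewrite /M updE (negPf x0).
  have M2 : M v (tape 2) = 0%R by rewrite /M updE.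
  by rewrite (upd_id Mx) (upd_id M2).
have := @runs_repeat _ _ x (tape 2) p n t X M T x2 _ _ ltXn.
rewrite !E /M [upd h ord0 (_ + Posz (0 * d))%R]upd_id ?mul0n ?addr0 //.
apply; [by apply: Treg; rewrite /is_register; lia|exact: Treg|].
move=> v le_vX.
have := pP (upd (upd (M v) x (X - v)%N) (tape 2) v).
rewrite !updE /= x1' x0' /M !updE /= h1 => /(_ erefl) H.
apply: runs_cast H _ (leqnn _).
congr pair; apply: functional_extensionality => i; rewrite !updE.
case: (i =P ord0) => [->|//] /=.
by rewrite x0'; lia.
Qed.

Lemma runs_row (h : heads) : h (tape 1) = 0%R ->
  runs (For (tape 1) (Move _ ord0 MoveRight)) (T, h)
    (T, upd h ord0 (h ord0 + Posz n)%R) (n * 5 + 4).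
Proof.
move=> h1.
have [|v T1 h' _ [-> ->]||T' [h' [H [TE hE]]]] :=
  @runs_for _ _ (tape 1) (Move _ ord0 MoveRight) n 1
  (fun v T' h' => T' = T /\ h' = upd h ord0 (h ord0 + Posz v)%R) T h.
- by move=> v T' h' [-> _]; apply: Treg.
- exists T, (upd h ord0 (h ord0 + Posz v.+1)%R); split=> //.
  apply: runs_cast (runs_move _ _ _ _) _ (leqnn _).
  congr pair; apply: functional_extensionality => i; rewrite !updE /=.
  by case: (i =P tape 1) => [->|_] //=; case: (i =P ord0) => //= _; lia.
- by rewrite addr0 upd_id.
move: H; rewrite TE hE upd_id // => H; apply: runs_cast H _ _; last by lia.
by rewrite upd_id.
Qed.

Definition goto_time := n * (n * 5 + 4 + 6) + 4 + (n * (1 + 6) + 4).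

Lemma runs_goto (x y : 'I_12) X Y (h : heads) :
    2 < x < 8 -> h x = Posz X -> X < n -> 2 < y < 8 -> h y = Posz Y -> Y < n ->
    h ord0 = 0%R -> h (tape 1) = 0%R -> h (tape 2) = 0%R ->
  runs (Goto x y) (T, h) (T, upd h ord0 (Posz (X.+1 * n + Y.+1))) goto_time.
Proof.
move=> xr hx ltXn yr hy ltYn h0 h1 h2.
have y0 : y != ord0 by apply: contraTneq yr => ->.
have rows := @runs_repeat_displace x _ _ n X h xr hx ltXn h1 h2 runs_row.
have Mright (h' : heads) : h' (tape 1) = 0%R ->
    runs (Move bool ord0 MoveRight) (T, h')
      (T, upd h' ord0 (h' ord0 + Posz 1)%R) 1.
  by move=> _; apply: runs_move.
have cells := @runs_repeat_displace y _ _ 1 Y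
  (upd h ord0 (h ord0 + Posz (X.+1 * n))%R) yr _ ltYn _ _ Mright.
apply: runs_cast (runs_seq rows (cells _ _ _)) _ (leqnn _);
  rewrite ?updE ?(negPf y0) //=.
by rewrite h0 upd_upd muln1; congr (_, upd _ _ _); lia.
Qed.

End Navigation.

Definition access_time n := goto_time n + (1 + ((n.+1 + n * n) * 2 + 2)).

(** * Abstract states and programs acting on them *)

Section Representation.
Variable G : sgraph.
Let n := #|G|.

Definition rank (x : G) : nat := enum_rank x.

Lemma rank_lt x : rank x < n. Proof. exact: ltn_ord. Qed.

Definition addr (x y : G) : nat := (rank x).+1 * n + (rank y).+1.

Lemma addr_lt x y : addr x y < n.+1 + n * n.
Proof. have := rank_lt y; have := leq_mul (rank_lt x) (leqnn n).
by rewrite /addr -/n; lia.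
Qed.

(** Division of [addr x y] - 1 by [n] has quotient [rank x] + 1; then [rank y] follows by
    cancellation. *)
Lemma addr_inj x y x' y' : addr x y = addr x' y' -> x = x' /\ y = y'.
Proof.
move=> E; have lty := rank_lt y; have lty' := rank_lt y'.
have addrE z t : addr z t = ((rank z).+1 * n + rank t).+1.
  by rewrite /addr addnS.
have rE : rank x = rank x'.
  have /(congr1 (fun m => m.-1 %/ n)) := E.
  have n0 : 0 < n by apply: leq_ltn_trans lty.
  by rewrite !addrE /= !divnMDl // !divn_small // !addn0 => -[].
split; apply: enum_rank_inj; apply: val_inj => //=; rewrite -/(rank _).
by move: E; rewrite !addrE rE => -[/addnI].
Qed.

(** Only the matrix and the flags: the contents of the registers stay fixed, and loop variables are
    head positions. *)
Definition state : Type := ((G -> G -> symbol) * ('I_12 -> symbol))%type.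

(** The first two fields are what rewinding tape 0 needs: a blank to the left of the word and none
    inside it. *)
Record represents (T : tapes) (s : state) : Prop := Represents {
  rep_left : T ord0 (-1)%R = None;
  rep_nonblank : forall z : nat, z < n.+1 + n * n -> T ord0 z;
  rep_register : forall i, is_register i -> T i = unary bool n;
  rep_matrix : forall x y, T ord0 (addr x y) = s.1 x y;
  rep_flag : forall i, is_flag i -> T i 0%R = s.2 i }.

Definition at_rest (h : heads) :=
  [/\ h ord0 = 0%R, h (tape 1) = 0%R, h (tape 2) = 0%R
    & forall i, is_flag i -> h i = 0%R].

(** All heads return to [h], through which the values of the loop variables enter. *)
Definition implements (h : heads) (p : program) (f : state -> state) t :=
  forall T s, represents T s ->
  exists2 T', runs p (T, h) (T', h) t & represents T' (f s).

Definition holds (h : heads) (i : 'I_12) (x : G) :=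
  2 < i < 8 /\ h i = Posz (rank x).

Lemma implements_seq h p q f g t u :
  implements h p f t -> implements h q g u ->
  implements h (Seq p q) (g \o f) (t + u).
Proof.
move=> pP qP T s /pP[T1 pT1 /qP[T2 qT2 T2P]].
by exists T2 => //; apply: runs_seq pT1 qT2.
Qed.

Lemma implements_if h b p q f g c t :
    (forall T s, represents T s -> b (scan (T, h)) = c s) ->
    implements h p f t -> implements h q g t ->
  implements h (If b p q) (fun s => if c s then f s else g s) t.+1.
Proof.
move=> bP pP qP T s sP; have [T1 pT1 fP] := pP _ _ sP.
have [T2 qT2 gP] := qP _ _ sP.
case cs: (c s); [exists T1 | exists T2] => //;
  by apply: runs_if; rewrite (bP _ _ sP) cs.
Qed.

Lemma implements_leq h p f t t' :
  t <= t' -> implements h p f t -> implements h p f t'.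
Proof.
by move=> le_t pP T s /pP[T' pT' fP]; exists T' => //; apply: runs_leq pT' le_t.
Qed.

(** Vertices are visited in the order of [enum G], in which [rank] is the position; the invariant is
    the fold over the first [v] of them. *)
Lemma implements_for (h : heads) (x : 'I_12) p (f : G -> state -> state) t :
    2 < x < 8 -> h x = 0%R ->
    (forall v : G, implements (upd h x (Posz (rank v))) p (f v) t) ->
  implements h (For x p) (fun s => foldl (fun s v => f v s) s (enum G))
    (n * (t + 4) + 4).
Proof.
move=> xr hx pP T s sP.
have xreg : is_register x by rewrite /is_register; lia.
pose F l := foldl (fun s v => f v s) s l.
have [|v T1 h1 lt_vn [T1P ->]||T' [h' [H [T'P hE]]]] :=
  @runs_for _ _ x p n t
  (fun v T' h' => represents T' (F (take v (enum G))) /\ h' = h) T h.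
- by move=> v T1 h1 [/rep_register-> // _].
- pose w : G := enum_val (Ordinal lt_vn).
  have [T2 pT2 T2P] := pP w _ _ T1P.
  rewrite /rank enum_valK /= in pT2.
  exists T2, h; split=> //; split=> //.
  have lt_v : v < size (enum G) by rewrite -cardE.
  have wE : nth w (enum G) v = w by rewrite {2}/w (enum_val_nth w).
  by rewrite (take_nth w) // /F -cats1 foldl_cat /= wE.
- by rewrite take0.
rewrite /n cardE take_size in T'P.
exists T' => //.
by move: H; rewrite hE !upd_id.
Qed.

Definition set_flag (i : 'I_12) (a : symbol) (s : state) : state :=
  (s.1, upd s.2 i a).

Definition fetch i (x y : G) (s : state) : state := set_flag i (s.1 x y) s.

Definition set_entry (x y : G) (a : symbol) (s : state) : state :=
  (fun x' y' => if (x' == x) && (y' == y) then a else s.1 x' y', s.2).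

Lemma represents_flag T s (i : 'I_12) a :
  represents T s -> is_flag i ->
  represents (write T i 0%R a) (set_flag i a s).
Proof.
case=> T1 Tn Tr Tm Tf fi.
have i0 : ord0 == i = false by apply: contraTF fi => /eqP <-.
split; rewrite /write ?updE ?i0 //= => j.
- move=> jr; rewrite updE -(Tr j jr); case: eqP => // jE.
  by move: fi jr; rewrite /is_flag /is_register jE; lia.
- by move=> jf; rewrite !updE; case: eqP => // _; apply: Tf.
Qed.

Lemma implements_write_flag (h : heads) (i : 'I_12) a : at_rest h -> is_flag i ->
  implements h (Write i (fun=> a)) (set_flag i a) 1.
Proof.
move=> [_ _ _ hf] fi T s sP; exists (write T i 0%R a).
  by rewrite -(hf i fi); apply: runs_write.
exact: represents_flag.
Qed.

Lemma implements_skip (h : heads) : implements h (Act (@idle _ _)) id 1.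
Proof. by move=> T s sP; exists T => //; rewrite -{2}[(T, h)]perform_idle. Qed.


Definition Access x y (p : program) : program :=
  Seq (Goto x y) (Seq p (Rewind _ ord0)).

(** The conditions on [T'] let the head return from the addressed cell to cell 0. *)
Lemma runs_access (i j : 'I_12) (p : program) x y (h : heads) (T T' : tapes) :
    (forall i, is_register i -> T i = unary bool n) ->
    at_rest h -> holds h i x -> holds h j y ->
    runs p (T, upd h ord0 (Posz (addr x y))) (T', upd h ord0 (Posz (addr x y))) 1 ->
    T' ord0 (-1)%R = None ->
    (forall z : nat, z < n.+1 + n * n -> T' ord0 z) ->
  runs (Access i j p) (T, h) (T', h) (access_time n).
Proof.
move=> Tr [h0 h1 h2 hf] [ir hi] [jr hj] pP T'1 T'n.
have gotoP := runs_goto Tr ir hi (rank_lt x) jr hj (rank_lt y) h0 h1 h2.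
have lt_a := addr_lt x y.
apply: runs_cast (runs_seq gotoP (runs_seq pP
  (@runs_rewind _ _ _ (addr x y).+1 _ _ _ T'1 _))) _ _.
- by move=> v lt_v; apply: T'n; apply: leq_trans lt_v _.
- by rewrite updE eqxx; lia.
- by rewrite upd_upd upd_id.
- by rewrite /access_time; lia.
Qed.

Definition Fetch x y f : program := Access x y (Write f (fun r => r ord0)).
Definition Store x y a : program := Access x y (Write ord0 (fun=> a)).

Lemma implements_fetch (h : heads) (i j f : 'I_12) x y :
    at_rest h -> holds h i x -> holds h j y -> is_flag f ->
  implements h (Fetch i j f) (fetch f x y) (access_time n).
Proof.
move=> hR hi hj ff T s sP; exists (write T f 0%R (s.1 x y)).
  have f0 : f == ord0 = false by apply: contraTF ff => /eqP ->.
  have f0' : ord0 == f = false by rewrite eq_sym.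
  apply: (@runs_access _ _ _ x y) => //.
  - exact: rep_register sP.
  - apply: runs_cast (runs_write _ _ _ _) _ (leqnn _).
    rewrite updE f0 ffunE /= updE eqxx (rep_matrix sP).
    by have [_ _ _ ->] := hR.
  - by rewrite /write updE f0'; apply: rep_left sP.
  - by move=> z; rewrite /write updE f0'; apply: rep_nonblank sP _.
exact: represents_flag.
Qed.

(** A stored blank would stop later rewinding, hence the condition on [a]. As addresses are
    injective, only one entry changes. *)
Lemma implements_store (h : heads) (i j : 'I_12) x y (a : symbol) :
    at_rest h -> holds h i x -> holds h j y -> a ->
  implements h (Store i j a) (set_entry x y a) (access_time n).
Proof.
move=> hR hi hj aN T s sP; exists (write T ord0 (Posz (addr x y)) a).
  apply: (@runs_access _ _ _ x y) => //.
  - exact: rep_register sP.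
  - exact: runs_write.
  - by rewrite /write updE eqxx; apply: rep_left sP.
  - move=> z lt_z; rewrite /write updE eqxx.
    by case: ifP => // _; apply: rep_nonblank sP _ lt_z.
case: sP => T1 Tn Tr Tm Tf.
split; rewrite /write ?updE ?eqxx //=.
- by move=> z lt_z; case: ifP => // _; apply: Tn.
- move=> k kr; rewrite updE -(Tr k kr); case: eqP => // kE.
  by move: kr; rewrite kE.
- move=> x' y'; rewrite -Tm; case: eqP => [[]|neq].
    by case/addr_inj=> -> ->; rewrite !eqxx.
  by case: ifP => // /andP[/eqP xE /eqP yE]; case: neq; rewrite xE yE.
- by move=> k kf; rewrite updE -(Tf k kf); case: eqP => // kE; move: kf; rewrite kE.
Qed.

(** * One round of propagation *)

Section Step.
Variable forb : symbol -> symbol -> symbol -> bool.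

(** A matched triple whose xz is an unmarked edge is a rule, and its conclusion is entered in both
    symmetric positions. Any other match violates a negative clause; this is recorded on tape 11,
    where [edge] is a mere mark. *)
Definition Triple : program :=
  Seq (Fetch (tape 3) (tape 4) (tape 8))
    (Seq (Fetch (tape 4) (tape 5) (tape 9))
      (Seq (Fetch (tape 3) (tape 5) (tape 10))
        (If (fun r => forb (r (tape 8)) (r (tape 9)) (r (tape 10)))
          (If (fun r => r (tape 10) == edge)
            (Seq (Store (tape 3) (tape 5) forced)
                 (Store (tape 5) (tape 3) forced))
            (Write (tape 11) (fun=> edge)))
          (Act (@idle _ _))))).

Definition judge (x z : G) (s : state) : state :=
  if forb (s.2 (tape 8)) (s.2 (tape 9)) (s.2 (tape 10)) then
    if s.2 (tape 10) == edge
    then (set_entry z x forced \o set_entry x z forced) s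
    else set_flag (tape 11) edge s
  else id s.

Definition triple (x y z : G) : state -> state :=
  judge x z \o fetch (tape 10) x z \o fetch (tape 9) y z \o fetch (tape 8) x y.

Lemma implements_triple (h : heads) x y z :
    at_rest h -> holds h (tape 3) x -> holds h (tape 4) y -> holds h (tape 5) z ->
  implements h Triple (triple x y z) ((access_time n) * 5 + 3).
Proof.
move=> hR h3 h4 h5.
have hflag T s i : represents T s -> is_flag i -> scan (T, h) i = s.2 i.
  by case: hR => _ _ _ hf sP fi; rewrite ffunE /= hf // (rep_flag sP).
apply: (@implements_leq _ _ _ ((access_time n) + ((access_time n) + ((access_time n)
  + (maxn (maxn ((access_time n) + (access_time n)) 1).+1 1).+1)))); first by lia.
apply: implements_seq (implements_fetch (f := tape 8) hR h3 h4 isT) _.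
apply: implements_seq (implements_fetch (f := tape 9) hR h4 h5 isT) _.
apply: implements_seq (implements_fetch (f := tape 10) hR h3 h5 isT) _.
apply: (@implements_if _ _ _ _ _ _
  (fun s => forb (s.2 (tape 8)) (s.2 (tape 9)) (s.2 (tape 10)))).
- by move=> T s sP; rewrite !(hflag _ _ _ sP).
- apply: implements_leq (leq_maxl _ _) _.
  apply: (@implements_if _ _ _ _ _ _ (fun s => s.2 (tape 10) == edge)).
  + by move=> T s sP; rewrite !(hflag _ _ _ sP).
  + apply: implements_leq (leq_maxl _ _) _.
    exact: implements_seq (implements_store (a := forced) hR h3 h5 isT)
      (implements_store (a := forced) hR h5 h3 isT).
  + apply: implements_leq (leq_maxr _ _) _.
    exact: implements_write_flag.
- apply: implements_leq (leq_maxr _ _) _.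
  exact: implements_skip.
Qed.

Definition sweep (f : G -> state -> state) (s : state) : state :=
  foldl (fun s v => f v s) s (enum G).

Definition Round : program :=
  For (tape 3) (For (tape 4) (For (tape 5) Triple)).

(** Updates are made in place: later triples of a round see the edges forced by earlier ones. *)
Definition round : state -> state :=
  sweep (fun x => sweep (fun y => sweep (fun z => triple x y z))).

Lemma at_rest_upd (h : heads) (i : 'I_12) v :
  2 < i < 8 -> at_rest h -> at_rest (upd h i v).
Proof.
move=> ir [h0 h1 h2 hf]; split; rewrite ?updE; first 3 last.
  move=> j jf; rewrite updE; case: eqP => [jE|_]; last exact: hf.
  by move: jf ir; rewrite jE /is_flag; lia.
all: by case: eqP => // iE; move: ir; rewrite -iE.
Qed.

Lemma implements_round (h : heads) :
    at_rest h -> h (tape 3) = 0%R -> h (tape 4) = 0%R -> h (tape 5) = 0%R ->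
  implements h Round round
    (n * (n * (n * ((access_time n) * 5 + 3 + 4) + 4 + 4) + 4 + 4) + 4).
Proof.
move=> hR h3 h4 h5.
apply: implements_for => // x; apply: implements_for => // y.
apply: implements_for => // z; apply: implements_triple => //.
by do 3 apply: at_rest_upd => //.
Qed.

End Step.

End Representation.

(** * The colouring machine *)

Lemma onth_allpairs (A B C : Type) (f : A -> B -> C) (s : seq A) (t : seq B) i j :
    j < size t ->
  onth [seq f x y | x <- s, y <- t] (i * size t + j) =
    obind (fun x => omap (f x) (onth t j)) (onth s i).
Proof.
move=> lt_j; elim: s i => [|x s IHs] i; first by rewrite !onth0n.
case: i => [|i] /=.
  by rewrite onth_cat size_map mul0n add0n lt_j onth_map.
rewrite onth_cat size_map mulSn -addnA ltnNge leq_addr /=.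
by rewrite addKn IHs.
Qed.

Section Encoding.
Variable G : sgraph.
Let n := #|G|.

Lemma size_encode : size (encode G) = n.+1 + n * n.
Proof. by rewrite /encode size_cat size_nseq /= size_allpairs -!cardE addnS. Qed.

Lemma onth_encode_prefix v : v < n -> onth (encode G) v = Some true.
Proof. by move=> lt_v; rewrite onth_cat size_nseq lt_v onth_nseq lt_v. Qed.

Lemma onth_encode_delimiter : onth (encode G) n = Some false.
Proof. by rewrite onth_cat size_nseq ltnn subnn. Qed.

(** After n ones and the delimiter, the entry in row i and column j sits at n + 1 + i n + j, which
    is [addr]. *)
Lemma onth_encode_adj (x y : G) : onth (encode G) (addr x y) = Some (adj x y).
Proof.
have addrE : addr x y = n + (rank x * n + rank y).+1 by rewrite /addr -/n; lia.
have onth_rank z : onth (enum G) (rank z) = Some z.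
  by rewrite onthE (nth_map z) -?cardE ?rank_lt // nth_enum_rank.
rewrite addrE onth_cat size_nseq ltnNge leq_addr addKn /=.
rewrite {1}/n cardE onth_allpairs -?cardE ?rank_lt //.
by rewrite !onth_rank.
Qed.

Definition AllMove d : program :=
  Act (fun r => [ffun i => (r i, if i < 8 then d else Stay)]).

(** The heads of tapes 0 to 7 move in step, so the leading ones are copied to all registers at once,
    up to the delimiter; [edge] is here just the bit true. The blank left of register 1 ends the way
    back. *)
Definition Setup : program :=
  Seq (While (fun r => r ord0 == edge)
        (Act (fun r => [ffun i => (if is_register i then edge else r i,
                                   if i < 8 then MoveRight else Stay)])))
      (Seq (AllMove MoveLeft)
        (Seq (While (fun r => r (tape 1)) (AllMove MoveLeft))
          (AllMove MoveRight))).

Definition base_tapes (v : nat) : tapes :=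
  fun i => if i == ord0 then word_tape bool (encode G)
           else if is_register i then unary bool v else fun=> None.

Definition base_heads (z : int) : heads := fun i => if i < 8 then z else 0%R.

Lemma runs_all_move d z T :
  runs (AllMove d) (T, base_heads z) (T, base_heads (shift d z)) 1.
Proof.
apply: runs_cast (runs_act _ _) _ (leqnn _); congr pair;
  apply: functional_extensionality => i.
  by apply: functional_extensionality => z'; rewrite !ffunE /=; case: eqP => [->|].
by rewrite !ffunE /= /base_heads; case: ifP.
Qed.

Lemma runs_setup :
  runs Setup (base_tapes 0, base_heads 0) (base_tapes n, base_heads 0)
    (n * 4 + 4).
Proof.
pose P (v : nat) (m : tapes * heads) := m = (base_tapes v, base_heads v).
have [|||m w1 m1] := @runs_while _ _ (fun r => r ord0 == edge)
  (Act (fun r => [ffun i => (if is_register i then edge else r i,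
                             if i < 8 then MoveRight else Stay)])) P n 1
  (base_tapes 0, base_heads 0).
- move=> v m lt_v ->; split.
    by rewrite ffunE /base_tapes /= onth_encode_prefix.
  eexists; first exact: runs_act.
  congr pair; apply: functional_extensionality => i /=; last first.
    by rewrite !ffunE /= /base_heads; case: ifP => //= _; lia.
  apply: functional_extensionality => z; rewrite !ffunE /= /base_tapes /base_heads.
  case: (i =P ord0) => [->|i0] /=; first by case: eqP => [->|].
  case: (boolP (is_register i)) => ir; last by case: ifP.
  have i8 : i < 8 by case/andP: ir.
  rewrite i8; case: z => z /=; last by [].
  by rewrite eqz_nat ltnS [in RHS]leq_eqVlt; case: (z =P v).
- by move=> m ->; rewrite ffunE /base_tapes /= onth_encode_delimiter.
- by [].
pose Q (v : nat) (m : tapes * heads) :=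
  m = (base_tapes n, base_heads (n%:Z - 1 - v%:Z)%R).
have [|||m' w2 m2] := @runs_while _ _ (fun r => r (tape 1)) (AllMove MoveLeft) Q n 1
  (base_tapes n, base_heads (n%:Z - 1)%R).
- move=> v m0 lt_v ->; split.
    rewrite ffunE /base_tapes /base_heads /=.
    have -> : (n%:Z - 1 - v%:Z)%R = (n - v.+1)%N by lia.
    by rewrite /= ifT //; lia.
  eexists; first exact: runs_all_move.
  by congr (_, base_heads _); rewrite /=; lia.
- move=> m0 ->; rewrite ffunE /base_tapes /base_heads /=.
  by rewrite (_ : (_ - _)%R = (-1)%R) //; lia.
- by rewrite /Q subr0.
rewrite m1 in w1; rewrite m2 in w2.
have w3 := runs_seq (runs_all_move MoveLeft n (base_tapes n))
  (runs_seq w2 (runs_all_move MoveRight _ _)).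
apply: runs_cast (runs_seq w1 w3) _ _.
  by congr (_, base_heads _); rewrite /=; lia.
lia.
Qed.

Definition input_state : state G :=
  (fun x y => if adj x y then edge else nonedge, fun=> None).

Lemma represents_input : represents (base_tapes n) input_state.
Proof.
split=> //.
- move=> z lt_z; rewrite /base_tapes /=.
  by have := onthTE (encode G) z; rewrite size_encode lt_z; case: onth.
- move=> i ir; rewrite /base_tapes ir ifF //.
  by apply: contraTF ir => /eqP ->.
- by move=> x y; rewrite /base_tapes /= onth_encode_adj /=; case: adj.
- move=> i fi; rewrite /base_tapes !ifF //.
    by apply: contraTF fi; rewrite /is_register /is_flag; lia.
  by apply: contraTF fi => /eqP ->.
Qed.

(** The diagonal reads [nonedge] in the input and is overwritten first, lest triples with repeated
    vertices match a clause. Tapes 6 and 7 only count n^2 further rounds. *)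
Definition Solve (forb : symbol -> symbol -> symbol -> bool) : program :=
  Seq Setup (Seq (For (tape 3) (Store (tape 3) (tape 3) diagonal))
    (Seq (Round forb) (For (tape 6) (For (tape 7) (Round forb))))).

Definition mark_diagonal : state G -> state G :=
  sweep (fun x => set_entry x x diagonal).

Definition solve forb : state G :=
  sweep (fun=> sweep (fun=> round forb)) (round forb (mark_diagonal input_state)).

End Encoding.

(** * Polynomial running time *)

Section Time.

(** Two arguments, because times depend on the number of vertices while the bound is taken at the
    length of the encoding. *)
Definition poly_bounded (f : nat -> nat) :=
  exists p : {poly nat}, forall m n, m <= n -> f m <= p.[n]%R.

Lemma poly_bounded_const c : poly_bounded (fun=> c).
Proof. by exists c%:P%R => m n _; rewrite hornerC. Qed.

Lemma poly_bounded_id : poly_bounded (fun n => n).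
Proof. by exists 'X%R => m n; rewrite hornerX. Qed.

Lemma poly_boundedD f g :
  poly_bounded f -> poly_bounded g -> poly_bounded (fun n => f n + g n).
Proof.
move=> [p pP] [q qP]; exists (p + q)%R => m n le_mn.
by rewrite hornerD leq_add ?pP ?qP.
Qed.

Lemma poly_boundedS f : poly_bounded f -> poly_bounded (fun n => (f n).+1).
Proof.
move=> [p pP]; exists (p + 1%:P)%R => m n le_mn.
by rewrite hornerD hornerC -addn1 leq_add ?pP.
Qed.

Lemma poly_boundedM f g :
  poly_bounded f -> poly_bounded g -> poly_bounded (fun n => f n * g n).
Proof.
move=> [p pP] [q qP]; exists (p * q)%R => m n le_mn.
by rewrite hornerM leq_mul ?pP ?qP.
Qed.

End Time.

Ltac poly_bounded_tac :=
  repeat first [ exact: poly_bounded_const | exact: poly_bounded_id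
               | apply: poly_boundedS
               | apply: poly_boundedD | apply: poly_boundedM ].

Definition round_time n :=
  n * (n * (n * (access_time n * 5 + 3 + 4) + 4 + 4) + 4 + 4) + 4.

(** The summands belong to the setup, the diagonal, the first round, the n^2 further rounds and the
    verdict. *)
Definition solve_time n :=
  n * 4 + 4 + (n * (access_time n + 4) + 4
    + (round_time n + (n * (n * (round_time n + 4) + 4 + 4) + 4))) + 1.

Lemma poly_bounded_solve_time : poly_bounded solve_time.
Proof.
rewrite /solve_time /round_time /access_time /goto_time.
poly_bounded_tac.
Qed.

Lemma run_solve (G : sgraph) forb :
  tm_verdict (cf_state (run (machine (Solve forb) (tape 11) (fun a => a != edge))
    (encode G) (solve_time #|G|))) = Some ((solve G forb).2 (tape 11) != edge).
Proof.
rewrite /solve_time addn1.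
have rest0 : at_rest (fun=> 0%R) by [].
have mainP : implements (G := G) (fun=> 0%R)
   (Seq (For (tape 3) (Store (tape 3) (tape 3) diagonal))
     (Seq (Round forb) (For (tape 6) (For (tape 7) (Round forb)))))
   ((sweep (fun=> sweep (fun=> round forb)) \o round forb) \o @mark_diagonal G)
   (#|G| * (access_time #|G| + 4) + 4
    + (round_time #|G| + (#|G| * (#|G| * (round_time #|G| + 4) + 4 + 4) + 4))).
  apply: implements_seq.
    apply: implements_for => // x.
    by apply: (implements_store (a := diagonal)) => //; apply: at_rest_upd.
  apply: implements_seq; first exact: implements_round.
  apply: implements_for => // x; apply: implements_for => // y.
  by apply: implements_round => //; do 2 apply: at_rest_upd => //.
have [T' T'P /rep_flag flagP] := mainP _ _ (represents_input G).
have setupP := @runs_setup G.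
have heads0 : base_heads 0 = (fun=> 0%R).
  by apply: functional_extensionality => i; rewrite /base_heads; case: ifP.
rewrite heads0 in setupP.
have tapes0 : base_tapes G 0 = (fun i => if i == ord0 then word_tape bool (encode G)
    else fun=> None).
  apply: functional_extensionality => i; rewrite /base_tapes.
  by case: eqP => // _; case: ifP => // _; apply: functional_extensionality => -[].
rewrite tapes0 in setupP.
by rewrite (machine_run _ _ (runs_seq setupP T'P)) /= flagP.
Qed.

(** * Correctness of the propagation *)

Section Correctness.
Variables (G : sgraph) (forb : symbol -> symbol -> symbol -> bool).
Hypothesis forbP : forall a b d, forb a b d ->
  [/\ a \in [:: nonedge; forced], b \in [:: nonedge; forced]
    & d \in [:: nonedge; edge; forced]].

Implicit Types (s : state G) (r : rel G).

(** The matrix with red relation [r]. As [diagonal] occurs in no forbidden triple, only distinct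
    vertices matter. *)
Definition entry r (x y : G) : symbol :=
  if x == y then diagonal
  else if adj x y then (if r x y then forced else edge) else nonedge.

Definition solution r :=
  symmetric r /\
  forall x y z, ~~ forb (entry r x y) (entry r y z) (entry r x z).

Definition red s : rel G := fun x y => s.1 x y == forced.

Definition rejected s := s.2 (tape 11) == edge.

(** Soundness of propagation: the marked edges are consequences of the clauses, and rejection
    excludes every solution. *)
Record invariant s : Prop := Invariant {
  inv_entry : forall x y, s.1 x y = entry (red s) x y;
  inv_sym : symmetric (red s);
  inv_forced : forall r, solution r -> subrel (red s) r;
  inv_rejected : forall r, rejected s -> ~ solution r }.

(** The entries [nonedge] and [forced] are final, since every solution contains the marked edges. *)
Lemma entry_agree s r x y : invariant s -> solution r ->
  s.1 x y \in [:: nonedge; forced] -> entry r x y = s.1 x y.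
Proof.
move=> sI rS; rewrite (inv_entry sI) /entry.
case: eqP => // _; case: (adj x y) => //.
by case: ifP => // /(inv_forced sI rS) ->.
Qed.

(** [X] stands for the triples that [g] inspects. If no new pair turns red, the matrix is unchanged,
    so the last clause can speak of [s]. *)
Definition covers (g : state G -> state G) (X : G -> G -> G -> Prop) :=
  forall s, invariant s ->
  [/\ invariant (g s), subrel (red s) (red (g s)), rejected s -> rejected (g s)
    & red (g s) =2 red s -> rejected (g s) \/
      forall x y z, X x y z -> ~~ forb (s.1 x y) (s.1 y z) (s.1 x z)].

Lemma eq_invariant s s' : s'.1 = s.1 -> s'.2 (tape 11) = s.2 (tape 11) ->
  invariant s -> invariant s'.
Proof.
case: s s' => [S f] [S' f'] /= -> bE [He Hs Hf Hr]; split=> // r.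
by rewrite /rejected /= bE; apply: Hr.
Qed.

(** The premises of a matched clause hold in every solution. So a negative clause refutes all
    solutions, and a rule puts xz into each of them. *)
Lemma triple_covers x y z :
  covers (triple forb x y z) (fun x' y' z' => [/\ x' = x, y' = y & z' = z]).
Proof.
move=> s sI; rewrite /triple /=; set t := fetch _ _ _ _.
have t1 : t.1 = s.1 by [].
have t11 : t.2 (tape 11) = s.2 (tape 11) by [].
have [t8 t9 t10] : [/\ t.2 (tape 8) = s.1 x y, t.2 (tape 9) = s.1 y z
  & t.2 (tape 10) = s.1 x z] by [].
have tI := eq_invariant t1 t11 sI.
rewrite /judge t8 t9 t10; clearbody t.
have redt : red t = red s by rewrite /red t1.
case: ifP => [fb|/negbT nfb] /=; last first.
  split=> //; first by rewrite redt.
    by rewrite /rejected t11.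
  by move=> _; right=> x' y' z' [-> -> ->].
have [ax ay az] := forbP fb.
case: (s.1 x z =P edge) az => [exz|nexz] az; last first.
  have azr : s.1 x z \in [:: nonedge; forced].
    by move: az nexz; rewrite !inE => /or3P[/eqP->|/eqP->|/eqP->].
  split=> //; last by left.
  (* All three entries are final, so any solution would contain the forbidden triple. *)
  - have [He Hs Hf _] := tI; split=> // r _ rS.
    have [_ /(_ x y z)] := rS.
    by rewrite (entry_agree sI rS ax) (entry_agree sI rS ay) (entry_agree sI rS azr) fb.
  - by rewrite -redt.
have [neq_xz adj_xz] : x != z /\ adj x z.
  move: exz; rewrite (inv_entry sI) /entry; case: eqP => // _.
  by case: (adj x z).
set t' := set_entry z x _ _.
have redt' u v : red t' u v = [|| (u == z) && (v == x), (u == x) && (v == z)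
    | red s u v].
  rewrite -redt /red /t' /=.
  by case: ifP => //= _; case: ifP => //= _.
split; first split.
- move=> u v; rewrite /entry redt' /=.
  case: ifP => [/andP[/eqP-> /eqP->]|zx].
    by rewrite eq_sym (negPf neq_xz) adj_sym adj_xz.
  case: ifP => [/andP[/eqP-> /eqP->]|xz]; first by rewrite (negPf neq_xz) adj_xz.
  by rewrite t1 (inv_entry sI).
- move=> u v; rewrite !redt' (inv_sym sI) andbC [(u == x) && _]andbC.
  by rewrite orbCA.
- move=> r rS u v.
  have rxz : r x z.
    (* With xz outside [r], the triple would read in [r] as it does in [s], which is forbidden. *)
    apply: contraT => nr; have [_ /(_ x y z)] := rS.
    rewrite (entry_agree sI rS ax) (entry_agree sI rS ay).
    by rewrite /entry (negPf neq_xz) adj_xz (negPf nr) -exz fb.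
  rewrite redt' => /or3P[/andP[/eqP-> /eqP->]|/andP[/eqP-> /eqP->]|] //.
    by case: rS => ->.
  exact: (inv_forced sI rS).
- by move=> r; rewrite /rejected /= t11; apply: inv_rejected sI _.
- by move=> u v ruv; rewrite redt' ruv !orbT.
- by rewrite /rejected /= t11.
(* The pair xz has just turned red, so the assumption of no change fails. *)
- move=> /(_ x z); rewrite redt' !eqxx /= orbT /red exz.
  by [].
Qed.

(** Red sets only grow: if the whole sweep changes nothing, no single step does, and all steps have
    inspected the same matrix. *)
Lemma sweep_covers f X : (forall v, covers (f v) (X v)) ->
  covers (sweep f) (fun x y z => exists v, X v x y z).
Proof.
move=> fX.
suff H l : covers (foldl (fun s v => f v s) ^~ l)
    (fun x y z => exists2 v, v \in l & X v x y z).
  move=> s /(H (enum G))[sI sub rej stable]; split=> // /stable[|st]; first by left.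
  by right=> x y z [v vX]; apply: st; exists v; rewrite ?mem_enum.
elim: l => [|v l IHl] s sI /=; first by split=> // _; right=> x y z [].
have [sI1 sub1 rej1 st1] := fX v s sI.
have [sI2 sub2 rej2 st2] := IHl _ sI1.
split=> //.
- by move=> x y /sub1/sub2.
- by move/rej1/rej2.
move=> E; set s2 := foldl _ _ _ in sI2 sub2 rej2 st2 E *.
have E1 : red (f v s) =2 red s.
  move=> x y; apply/idP/idP; last exact: sub1.
  by rewrite -E; apply: sub2.
have E2 : red s2 =2 red (f v s) by move=> x y; rewrite E E1.
have E11 x y : (f v s).1 x y = s.1 x y.
  by rewrite (inv_entry sI1) (inv_entry sI) /entry E1.
case: (st1 E1) => [/rej2|nf1]; first by left.
case: (st2 E2) => [|nf2]; first by left.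
right=> x y z [w]; rewrite inE => /orP[/eqP->|wl] wX; first exact: nf1.
by rewrite -!E11; apply: nf2; exists w.
Qed.

Lemma round_covers : covers (round forb) (fun _ _ _ => True).
Proof.
have H := sweep_covers (fun x =>
  sweep_covers (fun y => sweep_covers (triple_covers x y))).
move=> s /H[sI sub rej st]; split=> // /st[|st']; first by left.
by right=> x y z _; apply: st'; exists x, y, z.
Qed.

(** Both alternatives persist: rejection by [covers], the other because it does not mention the
    state. *)
Definition settled s := rejected s \/ exists r, solution r.

Definition num_red s := #|[set p : G * G | red s p.1 p.2]|.

Definition advances (g : state G -> state G) k :=
  forall s, invariant s ->
  [/\ invariant (g s), settled s -> settled (g s)
    & settled (g s) \/ num_red s + k <= num_red (g s)].

(** A round that forces nothing new has inspected all triples of one matrix: unless it rejects, the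
    red pairs form a solution. *)
Lemma round_advances : advances (round forb) 1.
Proof.
move=> s sI; have [gI sub rej st] := round_covers sI.
split=> //; first by case=> [/rej|]; [left | right].
have subset_red : [set p | red s p.1 p.2] \subset
    [set p | red (round forb s) p.1 p.2].
  by apply/subsetP=> p; rewrite !inE; apply: sub.
case: (eqVneq [set p : G * G | red s p.1 p.2]
              [set p | red (round forb s) p.1 p.2]) => [E|ne]; last first.
  right; rewrite addn1; apply: proper_card.
  by rewrite properEneq ne.
left; case: st => [x y||nf].
- by have /setP/(_ (x, y)) := E; rewrite !inE.
- by left.
right; exists (red s); split; first exact: inv_sym sI.
by move=> x y z; rewrite -!(inv_entry sI); apply: nf.
Qed.

Lemma advances_comp g h k l : advances g k -> advances h l -> advances (h \o g) (k + l).
Proof.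
move=> gA hA s /gA[gI gS gN]; have [hI hS hN] := hA _ gI.
split=> //; first by move/gS/hS.
case: gN => [/hS|leg]; first by left.
by case: hN => [|leh]; [left | right => /=; lia].
Qed.

Lemma advances_sweep g k : advances g k -> advances (sweep (fun=> g)) (#|G| * k).
Proof.
move=> gA; rewrite cardE /sweep.
elim: (enum G) => [|v l IHl]; first by move=> s sI; split=> //; right; rewrite addn0.
exact: advances_comp gA IHl.
Qed.

Lemma mark_diagonalE :
  (forall x y, (mark_diagonal (input_state G)).1 x y =
     if x == y then diagonal else if adj x y then edge else nonedge) /\
  (mark_diagonal (input_state G)).2 = fun=> None.
Proof.
rewrite /mark_diagonal /sweep.
suff H l s : let s' := foldl (fun s v => set_entry v v diagonal s) s l in
    (forall x y, s'.1 x y = if (x == y) && (x \in l) then diagonal else s.1 x y)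
    /\ s'.2 = s.2.
  have [H1 H2] := H (enum G) (input_state G); split=> // x y.
  by rewrite H1 mem_enum andbT.
elim: l s => [|v l IHl] s; first by split=> // x y; rewrite andbF.
have [H1 H2] := IHl (set_entry v v diagonal s); split; rewrite ?H2 //= => x y.
rewrite H1 inE /=; case: (x =P y) => [<-|nxy] /=.
  by rewrite andbb; case: (x =P v) => //=; case: ifP.
by case: ifP => // /andP[/eqP xv /eqP yv]; case: nxy; rewrite xv yv.
Qed.

(** Until matters are settled, each of the n^2 + 1 rounds adds a red pair, but there are only n^2
    pairs. Conversely, the invariant forbids rejection when a solution exists. *)
Lemma solve_correct :
  (solve G forb).2 (tape 11) != edge <-> exists r, solution r.
Proof.
have [H1 H2] := mark_diagonalE.
have I0 : invariant (mark_diagonal (input_state G)).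
  have red0 x y : red (mark_diagonal (input_state G)) x y = false.
    by rewrite /red H1; do 2 case: ifP => // _.
  split=> [x y|x y|r _ x y|r].
  - by rewrite /entry red0 H1.
  - by rewrite !red0.
  - by rewrite red0.
  - by rewrite /rejected H2.
have := advances_comp round_advances
  (advances_sweep (advances_sweep round_advances)).
move=> /(_ _ I0)[finI _ fin]; rewrite -[_ (mark_diagonal _)]/(solve G forb) in finI fin.
split=> [nrej|[r rS]]; last by apply/negP=> /(inv_rejected finI)/(_ rS).
case: fin => [[rej|//]|]; first by rewrite /rejected (negPf nrej) in rej.
have : num_red (solve G forb) <= #|{: G * G}| by apply: max_card.
by rewrite card_prod; lia.
Qed.

End Correctness.

(** * Patterns as Horn clauses *)

Lemma ciso_trans C D E : ciso C D -> ciso D E -> ciso C E.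
Proof.
move=> [f [fB fA fC]] [g [gB gA gC]]; exists (g \o f); split=> [|x y|x y xy] /=.
- exact: bij_comp.
- by rewrite gA fA.
- by rewrite gC ?fA // fC.
Qed.

Lemma ciso_sym C D : ciso C D -> ciso D C.
Proof.
move=> [f [[g fK gK] fA fC]]; exists g; split; first by exists f.
  by move=> x y; rewrite -fA !gK.
by move=> x y xy; rewrite -fC ?gK // -fA !gK.
Qed.

(** The successor modulo 3 rotates the three pairs; with [pat_rev], which exchanges 01 and 12, it
    yields every order of the labels. *)
Lemma pat_rot a b d : ciso (pat a b d) (pat d a b).
Proof.
exists (@ordS 3); split; first exact: ordS_bij.
  by move=> [[|[|[|i]]] Hi] // [[|[|[|j]]] Hj].
by move=> [[|[|[|i]]] Hi] // [[|[|[|j]]] Hj].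
Qed.

Lemma pat_rev a b d : ciso (pat a b d) (pat b a d).
Proof.
exists (@rev_ord 3); split; first exact: (inv_bij (@rev_ordK 3)).
  by move=> [[|[|[|i]]] Hi] // [[|[|[|j]]] Hj].
by move=> [[|[|[|i]]] Hi] // [[|[|[|j]]] Hj].
Qed.

Definition label (C : cgraph) (x y : C) : option colour :=
  if adj x y then Some (edge_col C x y) else None.

Lemma label_sym (C : cgraph) (x y : C) : label x y = label y x.
Proof. by rewrite /label adj_sym col_sym. Qed.

Lemma label_pat a b d (i j : pat a b d) : i != j -> label i j = pat_label a b d i j.
Proof.
rewrite /label /= /pat_adj /pat_col => -> /=.
by case: pat_label.
Qed.

Lemma ciso_label (C D : cgraph) (f : C -> D) :
    (forall x y, adj (f x) (f y) = adj x y) ->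
    (forall x y, adj x y -> edge_col D (f x) (f y) = edge_col C x y) ->
  forall x y, label (f x) (f y) = label x y.
Proof. by move=> fA fC x y; rewrite /label fA; case: ifP => // /fC ->. Qed.

(** Passes from induced subgraphs to labelled triples of vertices, the form in which patterns are
    clauses. *)
Lemma induced_pat (C : cgraph) a b d :
  (exists S : {set C}, ciso (induced S) (pat a b d)) <->
  exists x y z : C, [/\ x != y, y != z & x != z] /\
    [/\ label x y = a, label y z = b & label x z = d].
Proof.
split=> [[S /ciso_sym[f [fB fA fC]]]|[x [y [z [[xy yz xz] [la lb ld]]]]]].
  have fI i j : (val (f i) == val (f j)) = (i == j).
    by rewrite (inj_eq val_inj) (inj_eq (bij_inj fB)).
  have fL i j : i != j -> label (val (f i)) (val (f j)) = pat_label a b d i j.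
    by move=> /label_pat <-; apply: (ciso_label fA fC).
  pose o k : 'I_3 := inord k.
  exists (val (f (o 0))), (val (f (o 1))), (val (f (o 2))).
  have o01 : o 0 != o 1 by rewrite -val_eqE /= !inordK.
  have o12 : o 1 != o 2 by rewrite -val_eqE /= !inordK.
  have o02 : o 0 != o 2 by rewrite -val_eqE /= !inordK.
  split; first by rewrite !fI.
  by rewrite !fL // /pat_label !inordK.
pose p (i : 'I_3) : C := nth x [:: x; y; z] i.
have pL i j : i != j -> label (p i) (p j) = pat_label a b d i j.
  case: i => [[|[|[|i]]] Hi] //; case: j => [[|[|[|j]]] Hj] //= _;
  by rewrite /p /pat_label //= label_sym.
have pI : injective p.
  have u : uniq [:: x; y; z] by rewrite /= !inE negb_or xy yz xz.
  by move=> i j /eqP; rewrite nth_uniq ?(valP i) ?(valP j) // => /eqP/val_inj.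
pose S := [set p i | i : 'I_3].
have pS i : p i \in S by apply: imset_f.
pose f (i : pat a b d) : induced S := exist _ (p i) (pS i).
exists S; apply: ciso_sym; exists f.
have fL i j : adj i j = adj (f i) (f j) /\
    (adj i j -> edge_col _ (f i) (f j) = edge_col (pat a b d) i j).
  case: (eqVneq i j) => [->|ij]; first by rewrite !adj_irr.
  have := pL i j ij; rewrite -label_pat // /label -[adj (p i) (p j)]/(adj (f i) (f j)).
  by case: (adj i j); case: (adj _ _) => // -[].
split=> [|i j|i j /(proj2 (fL i j))//]; last by case: (fL i j).
apply: inj_card_bij => [i j /(congr1 val)/= /pI //|].
by rewrite card_sig /S card_imset // card_ord.
Qed.

(** * Patterns as forbidden triples, with [q] as the forced colour *)

Section Translation.
Variable q : colour.

Definition opposite := if q is Red then Blue else Red.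
Definition is_q (c : colour) :=
  match q, c with Red, Red | Blue, Blue => true | _, _ => false end.

Lemma is_qE c : c = if is_q c then q else opposite.
Proof. by rewrite /is_q /opposite; case: q; case: c. Qed.

(** Reads a matrix as a colouring: edges left unmarked get the opposite colour; diagonal and blank
    fall under the default. *)
Definition symbol_label (a : symbol) : option colour :=
  match a with
  | Some (inl true) => Some opposite
  | Some (inr true) => Some q
  | _ => None
  end.

Definition triple_pat (t : symbol * symbol * symbol) : cgraph :=
  pat (symbol_label t.1.1) (symbol_label t.1.2) (symbol_label t.2).

Lemma symbol_label_entry (G : sgraph) (c : colouring G) (x y : G) : x != y ->
  symbol_label (entry (fun x y => is_q (c x y)) x y) = @label (CGraph c) x y.
Proof.
move=> /negPf xy; rewrite /entry /label xy /=; case: adj => //.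
by rewrite [in RHS](is_qE (c x y)); case: is_q.
Qed.

Lemma symbol_label_inj a b : a != diagonal -> b != diagonal -> a -> b ->
  symbol_label a = symbol_label b -> a = b.
Proof.
by case: a => [[[]|[]]|] // _; case: b => [[[]|[]]|] //; rewrite /= /opposite; case: q.
Qed.

(* The colours of xy, yz and xz, in this order. *)
Definition templates : seq (symbol * symbol * symbol) :=
  [:: (nonedge, nonedge, nonedge); (nonedge, nonedge, edge);
      (nonedge, nonedge, forced); (forced, nonedge, forced);
      (forced, nonedge, edge); (forced, forced, forced);
      (forced, forced, edge)].

(** Membership in an arbitrary [F] is no boolean test; classical logic selects the relevant
    templates, which are then built into the machine. *)
Lemma classical_filter (T : eqType) (P : T -> Prop) (l : seq T) :
  exists l' : seq T, forall t, t \in l' <-> t \in l /\ P t.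
Proof.
elim: l => [|x l [l' IHl]]; first by exists [::] => t; split=> [|[]].
case: (classic (P x)) => Px.
  exists (x :: l') => t; rewrite !inE.
  split=> [/orP[/eqP->|/IHl[-> ?]]|[/orP[->//|tl] Pt]].
  - by rewrite eqxx.
  - by rewrite orbT.
  - by apply/orP; right; apply/IHl.
exists l' => t; rewrite !inE IHl; split=> [[-> ?]|[/orP[/eqP->//|-> //]]].
by rewrite orbT.
Qed.

Variable F : cgraph -> Prop.
Hypothesis FP : forall H, F H -> exists2 t, t \in templates & ciso H (triple_pat t).

(** The forbidden triples are the templates isomorphic to members of [F]; a solution is the class of
    colour [q] of a free colouring. *)
Lemma free_solution_exists :
  exists2 forb : symbol -> symbol -> symbol -> bool,
    (forall a b d, forb a b d ->
      [/\ a \in [:: nonedge; forced], b \in [:: nonedge; forced]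
        & d \in [:: nonedge; edge; forced]]) &
    forall G : sgraph, free_colouring_problem F G <-> exists r : rel G, solution forb r.
Proof.
have [l lP] := classical_filter
  (fun t => exists2 H, F H & ciso H (triple_pat t)) templates.
exists (fun a b d => (a, b, d) \in l).
  move=> a b d /lP[+ _]; rewrite !inE !xpair_eqE.
  by do 6?[case/orP]; case/andP=> /andP[/eqP-> /eqP->] /eqP->.
move=> G; split=> [[c cF]|[r [r_sym rP]]].
  exists (fun x y => is_q (c x y)); split=> [x y|x y z]; first by rewrite col_sym.
  apply/negP=> /lP[tT [H FH Ht]].
  have ne u v : entry (fun x y => is_q (c x y)) u v != diagonal -> u != v.
    by apply: contraNneq => ->; rewrite /entry eqxx.
  (* No template contains [diagonal]. *)
  have [xy yz xz] : [/\ x != y, y != z & x != z].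
    move: tT; rewrite !inE !xpair_eqE.
    by do 6?[case/orP]; case/andP=> /andP[/eqP e1 /eqP e2] /eqP e3;
      split; apply: ne; rewrite ?e1 ?e2 ?e3.
  have [S SP] : exists S : {set CGraph c}, ciso (induced S)
      (pat (@label (CGraph c) x y) (@label (CGraph c) y z) (@label (CGraph c) x z)).
    by apply/induced_pat; exists x, y, z.
  apply: (cF S H FH); apply: ciso_trans SP (ciso_sym _).
  by move: Ht; rewrite /triple_pat /= !symbol_label_entry.
(* Conversely, pairs in [r] get colour [q] and all others the opposite one. *)
have c_sym x y : (if r x y then q else opposite) = if r y x then q else opposite.
  by rewrite r_sym.
exists (Colouring c_sym) => S H FH SH.
have [t tT Ht] := FP FH.
have [|x [y [z [[xy yz xz] [la lb ld]]]]] := (induced_pat (CGraph (Colouring c_sym))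
  (symbol_label t.1.1) (symbol_label t.1.2) (symbol_label t.2)).1.
  by exists S; apply: ciso_trans SH Ht.
have rE u v : entry (fun x y => is_q (if r x y then q else opposite)) u v = entry r u v.
  by rewrite /entry; case: (r u v); rewrite /is_q /opposite; case: q.
have entryE u v a : u != v -> @label (CGraph (Colouring c_sym)) u v = symbol_label a ->
    a != diagonal -> a -> entry r u v = a.
  move=> uv luv ad aN; apply: symbol_label_inj => //.
  - by rewrite /entry (negPf uv); do 2 case: ifP => // _.
  - by rewrite /entry (negPf uv); do 2 case: ifP => // _.
  - by rewrite -luv -symbol_label_entry // -rE.
have [ta tb td] : [/\ entry r x y = t.1.1, entry r y z = t.1.2 & entry r x z = t.2].
  by move: tT; rewrite !inE; do 6?[case/orP]; move=> /eqP tE;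
    split; apply: entryE; rewrite // tE.
have /negP[] := rP x y z; apply/lP; rewrite ta tb td.
by case: t tT Ht {la lb ld ta tb td} => [[a b] d] tT Ht; split=> //; exists H.
Qed.

End Translation.

(** * The two lists of patterns and the theorem *)

(** Each pattern has at most one blue edge, which is brought to the last place as the negated
    conclusion of a rule. *)
Lemma among_templates_red F :
    among F [:: e3K1; r_coP3; b_coP3; r_P3; rb_P3; r_K3; rrb_K3] ->
  forall H, F H -> exists2 t, t \in templates & ciso H (triple_pat Red t).
Proof.
move=> FP H /FP[P PP HP].
have rot2 a b d : ciso (pat a b d) (pat b d a).
  exact: ciso_trans (pat_rot _ _ _) (pat_rot _ _ _).
case: PP => [|[|[|[|[|[|[|[]]]]]]]] E; rewrite -{}E in HP.
- by exists (nonedge, nonedge, nonedge).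
- by exists (nonedge, nonedge, forced) => //; apply: ciso_trans HP (rot2 _ _ _).
- by exists (nonedge, nonedge, edge) => //; apply: ciso_trans HP (rot2 _ _ _).
- by exists (forced, nonedge, forced) => //; apply: ciso_trans HP (rot2 _ _ _).
- exists (forced, nonedge, edge) => //; apply: ciso_trans HP _.
  exact: ciso_trans (pat_rot _ _ _) (pat_rev _ _ _).
- by exists (forced, forced, forced).
- by exists (forced, forced, edge).
Qed.

(** With blue as the forced colour, each pattern has at most one red edge, and it comes last. *)
Lemma among_templates_blue F :
    among F [:: e3K1; r_coP3; b_coP3; b_P3; rb_P3; b_K3; rbb_K3] ->
  forall H, F H -> exists2 t, t \in templates & ciso H (triple_pat Blue t).
Proof.
move=> FP H /FP[P PP HP].
have rot2 a b d : ciso (pat a b d) (pat b d a).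
  exact: ciso_trans (pat_rot _ _ _) (pat_rot _ _ _).
case: PP => [|[|[|[|[|[|[|[]]]]]]]] E; rewrite -{}E in HP.
- by exists (nonedge, nonedge, nonedge).
- by exists (nonedge, nonedge, edge) => //; apply: ciso_trans HP (rot2 _ _ _).
- by exists (nonedge, nonedge, forced) => //; apply: ciso_trans HP (rot2 _ _ _).
- by exists (forced, nonedge, forced) => //; apply: ciso_trans HP (rot2 _ _ _).
- by exists (forced, nonedge, edge) => //; apply: ciso_trans HP (rot2 _ _ _).
- by exists (forced, forced, forced).
- by exists (forced, forced, edge) => //; apply: ciso_trans HP (rot2 _ _ _).
Qed.

Theorem lemma38 (F : cgraph -> Prop)
  (F3 : forall H : cgraph, F H -> #|H| = 3)
  (hF : among F [:: e3K1; r_coP3; b_coP3; r_P3; rb_P3; r_K3; rrb_K3] \/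
        among F [:: e3K1; r_coP3; b_coP3; b_P3; rb_P3; b_K3; rbb_K3]) :
  polytime_solvable encode (free_colouring_problem F).
Proof.
have [q FP] : exists q, forall H, F H ->
    exists2 t, t \in templates & ciso H (triple_pat q t).
  by case: hF => [/among_templates_red|/among_templates_blue]; [exists Red | exists Blue].
have [forb forbP solE] := free_solution_exists FP.
have [p pP] := poly_bounded_solve_time.
exists (machine (Solve forb) (tape 11) (fun a => a != edge)), p => G.
exists (solve_time #|G|), ((solve G forb).2 (tape 11) != edge); split.
(* The number n of vertices is below the length n + 1 + n^2 of the encoding. *)
- by apply: pP; rewrite size_encode; lia.
- exact: run_solve.
- by rewrite solve_correct // solE.
Qed.
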